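(* Soft $\pi g\widehat{D}$-normality is a topological property: if $X$ and $Y$ are homeomorphic topological spaces and $X$ is softly $\pi g\widehat{D}$-normal, then $Y$ is softly $\pi g\widehat{D}$-normal.
   Context: No separation axioms are assumed on topological spaces; $cl$ and $int$ denote closure and interior, and $\subset$ allows equality. Let $A$ be a subset of a topological space $X$. - $A$ is regular(ly) open if $A=int(cl(A))$; $\pi$-open if it is a finite union of regular open sets; pre-open if $A\subset int(cl(A))$; semi-open if $A\subset cl(int(A))$; semi-preopen if $A\subset cl(int(cl(A)))$. Complements of these are called, respectively, regular(ly) closed, $\pi$-closed, pre-closed, semi-closed, semi-preclosed. - $pcl(A)$ (resp. $spcl(A)$) is the intersection of all pre-closed (resp. semi-preclosed) sets containing $A$. - $A$ is $w$-closed if $cl(A)\subset U$ whenever $A\subset U$ and $U$ is semi-open; $w$-open sets are complements of $w$-closed sets. - $A$ is $D$-closed if $pcl(A)\subset int(U)$ whenever $A\subset U$ and $U$ is $w$-open; $D$-open sets are complements of $D$-closed sets. - $A$ is $\widehat{D}$-closed if $spcl(A)\subset U$ whenever $A\subset U$ and $U$ is $D$-open. $\widehat{D}cl(A)$ is the intersection of all $\widehat{D}$-closed sets containing $A$. - $A$ is $\pi g\widehat{D}$-closed if $\widehat{D}cl(A)\subset U$ whenever $A\subset U$ and $U$ is $\pi$-open; $\pi g\widehat{D}$-open sets are complements of $\pi g\widehat{D}$-closed sets. - $X$ is softly $\pi g\widehat{D}$-normal if for any two disjoint subsets $A,B$ of $X$, one of which is $\pi$-closed and the other regularly closed, there exist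 disjoint $\pi g\widehat{D}$-open sets $U,V$ of $X$ with $A\subset U$ and $B\subset V$. *)

(* Defs.v *)
From mathcomp Require Import all_boot all_order all_algebra.
From mathcomp Require Import all_classical topology.

Set Implicit Arguments.
Unset Strict Implicit.
Unset Printing Implicit Defensive.

Local Open Scope classical_set_scope.

Section GeneralizedSets.
Context {T : topologicalType}.
Implicit Types A U : set T.

Definition pi_open A :=
  exists F : set (set T),
    [/\ finite_set F, F `<=` @regopen T & A = \bigcup_(U in F) U].
Definition pi_closed A := pi_open (~` A).

(* The library's [regclosed] is stated as [closure A° = A]. *)
Lemma regclosed_setC A : regclosed A <-> regopen (~` A).
Proof.
rewrite /regclosed /regopen closure_setC interiorC; split=> [-> //|].
exact: (@setC_inj T).
Qed.

Definition preopen A := A `<=` (closure A)°.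
Definition preclosed A := preopen (~` A).

Definition semiopen A := A `<=` closure A°.

Definition semipreopen A := A `<=` closure (closure A)°.
Definition semipreclosed A := semipreopen (~` A).

(* [smallest C A] is the intersection of all the supersets of [A] in [C];
   it need not itself belong to [C]. *)
Definition pcl A := smallest preclosed A.
Definition spcl A := smallest semipreclosed A.

Definition w_closed A :=
  forall U, A `<=` U -> semiopen U -> closure A `<=` U.
Definition w_open A := w_closed (~` A).

Definition D_closed A := forall U, A `<=` U -> w_open U -> pcl A `<=` U°.
Definition D_open A := D_closed (~` A).

Definition Dhat_closed A := forall U, A `<=` U -> D_open U -> spcl A `<=` U.
Definition Dhat_cl A := smallest Dhat_closed A.

Definition pigDhat_closed A :=
  forall U, A `<=` U -> pi_open U -> Dhat_cl A `<=` U.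
Definition pigDhat_open A := pigDhat_closed (~` A).

End GeneralizedSets.

Definition softly_pigDhat_normal (T : topologicalType) :=
  forall A B : set T, A `&` B = set0 ->
    (pi_closed A /\ regclosed B) \/ (regclosed A /\ pi_closed B) ->
  exists U V : set T,
    [/\ pigDhat_open U, pigDhat_open V, U `&` V = set0, A `<=` U & B `<=` V].

Definition homeomorphic (X Y : topologicalType) :=
  exists (f : X -> Y) (g : Y -> X),
    [/\ continuous f, continuous g, cancel f g & cancel g f].

(* Main.v *)
Require Import Defs.
From mathcomp Require Import all_boot all_order all_algebra.
From mathcomp Require Import all_classical topology.

(** Every class of sets in the definition of soft normality is built from
    interior, closure, complement and inclusion, so it is stable under preimage
    by a homeomorphism.  Since the inverse of a homeomorphism is again one, an
    inclusion [K (f^-1 A) <= f^-1 (K A)] natural in [f] is an equality. *)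

Local Open Scope classical_set_scope.

Definition homeo (X Y : topologicalType) (f : X -> Y) (g : Y -> X) :=
  [/\ continuous f, continuous g, cancel f g & cancel g f].

Lemma homeo_sym (X Y : topologicalType) (f : X -> Y) (g : Y -> X) :
  homeo X Y f g -> homeo Y X g f.
Proof. by case. Qed.

Lemma preimage_cancel {S T : Type} {f : S -> T} {g : T -> S} (fK : cancel f g)
  (A : set S) : f @^-1` (g @^-1` A) = A.
Proof. by rewrite -comp_preimage; apply/seteqP; split=> x /=; rewrite fK. Qed.

Lemma sub_preimage_cancel {S T : Type} {f : S -> T} {g : T -> S}
  (gK : cancel g f) (A : set T) (U : set S) :
  f @^-1` A `<=` U -> A `<=` g @^-1` U.
Proof. by move=> AU y Ay; apply: AU; rewrite /= gK. Qed.

(** [P] is a family over all spaces, since [f] relates two of them. One implication suffices: the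
    converse is the case of [g]. *)
Definition invariant_class (P : forall T : topologicalType, set T -> Prop) :=
  forall (X Y : topologicalType) (f : X -> Y) (g : Y -> X), homeo X Y f g ->
  forall A : set Y, P Y A -> P X (f @^-1` A).

Definition invariant_op (K : forall T : topologicalType, set T -> set T) :=
  forall (X Y : topologicalType) (f : X -> Y) (g : Y -> X), homeo X Y f g ->
  forall A : set Y, K X (f @^-1` A) = f @^-1` (K Y A).

Lemma invariant_op_sub (K : forall T : topologicalType, set T -> set T) :
  (forall (X Y : topologicalType) (f : X -> Y) (g : Y -> X), homeo X Y f g ->
   forall A : set Y, K X (f @^-1` A) `<=` f @^-1` (K Y A)) ->
  invariant_op K.
Proof.
move=> Ksub X Y f g fg A; have [_ _ fK gK] := fg.
apply/seteqP; split; first exact: Ksub _ _ _ _ fg A.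
rewrite -{1}(preimage_cancel gK A) -[X in _ `<=` X](preimage_cancel fK).
exact: preimage_subset (Ksub _ _ _ _ (homeo_sym _ _ _ _ fg) _).
Qed.

Lemma invariant_closure : invariant_op (@closure).
Proof.
apply: invariant_op_sub => X Y f g [cf _ _ _] A x clx B /cf/clx [z [Az Bz]].
by exists (f z).
Qed.

Lemma invariant_interior : invariant_op (@interior).
Proof.
move=> X Y f g fg A; apply: setC_inj.
by rewrite preimage_setC -!closure_setC preimage_setC
  (invariant_closure _ _ _ _ fg).
Qed.

Lemma invariant_setC (P : forall T : topologicalType, set T -> Prop) :
  invariant_class P -> invariant_class (fun T A => P T (~` A)).
Proof.
move=> Pinv X Y f g fg A; rewrite preimage_setC.
exact: Pinv _ _ _ _ fg _.
Qed.

(** Any [B] competing in the intersection for [A] gives a competitor [f @^-1] B[for]f @^-1[A]; the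
    intersection itself may fail [P]. *)
Lemma invariant_smallest (P : forall T : topologicalType, set T -> Prop) :
  invariant_class P -> invariant_op (fun T => smallest (P T)).
Proof.
move=> Pinv; apply: invariant_op_sub => X Y f g fg A x Ax B [PB AB].
apply: (Ax (f @^-1` B)); split; first exact: Pinv _ _ _ _ fg _ PB.
exact: preimage_subset.
Qed.

(** Common pattern of [w_closed], [D_closed], [Dhat_closed] and [pigDhat_closed]; [L] is the
    interior for [D_closed] and the identity otherwise. A test set [U] for [f @^-1]
    A[is the preimage of]g @^-1[U], a test set for [A]. *)
Lemma invariant_generalized_closed
  (P : forall T : topologicalType, set T -> Prop)
  (K L : forall T : topologicalType, set T -> set T) :
  invariant_class P -> invariant_op K -> invariant_op L ->
  invariant_class (fun T A => forall U, A `<=` U -> P T U -> K T A `<=` L T U).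
Proof.
move=> Pinv Kinv Linv X Y f g fg A clA U AU PU; have [_ _ fK gK] := fg.
rewrite (Kinv _ _ _ _ fg) -(preimage_cancel fK U) (Linv _ _ _ _ fg).
apply: preimage_subset; apply: clA; first exact: sub_preimage_cancel gK _ _ AU.
exact: Pinv _ _ _ _ (homeo_sym _ _ _ _ fg) _ PU.
Qed.

Lemma invariant_op_id : invariant_op (fun T A => A).
Proof. by []. Qed.

Lemma invariant_regopen : invariant_class (@regopen).
Proof.
move=> X Y f g fg A; rewrite /regopen.
by rewrite (invariant_closure _ _ _ _ fg) (invariant_interior _ _ _ _ fg) => ->.
Qed.

Lemma invariant_regclosed : invariant_class (@regclosed).
Proof.
move=> X Y f g fg A; rewrite /regclosed.
by rewrite (invariant_interior _ _ _ _ fg) (invariant_closure _ _ _ _ fg) => ->.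
Qed.

Lemma invariant_pi_open : invariant_class (@pi_open).
Proof.
move=> X Y f g fg A [F [finF regF ->]].
exists (preimage f @` F); split; first exact: finite_image.
  by move=> _ [U FU <-]; apply: invariant_regopen _ _ _ _ fg _ (regF _ FU).
by rewrite bigcup_image preimage_bigcup.
Qed.

Lemma invariant_semiopen : invariant_class (@semiopen).
Proof.
move=> X Y f g fg A sA; rewrite /semiopen.
rewrite (invariant_interior _ _ _ _ fg) (invariant_closure _ _ _ _ fg).
exact: preimage_subset.
Qed.

Lemma invariant_preopen : invariant_class (@preopen).
Proof.
move=> X Y f g fg A pA; rewrite /preopen.
rewrite (invariant_closure _ _ _ _ fg) (invariant_interior _ _ _ _ fg).
exact: preimage_subset.
Qed.

Lemma invariant_semipreopen : invariant_class (@semipreopen).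
Proof.
move=> X Y f g fg A sA; rewrite /semipreopen (invariant_closure _ _ _ _ fg).
rewrite (invariant_interior _ _ _ _ fg) (invariant_closure _ _ _ _ fg).
exact: preimage_subset.
Qed.

Lemma invariant_w_open : invariant_class (@w_open).
Proof.
exact: invariant_setC (invariant_generalized_closed _ _ _
  invariant_semiopen invariant_closure invariant_op_id).
Qed.

Lemma invariant_D_open : invariant_class (@D_open).
Proof.
exact: invariant_setC (invariant_generalized_closed _ _ _ invariant_w_open
  (invariant_smallest _ (invariant_setC _ invariant_preopen))
  invariant_interior).
Qed.

Lemma invariant_Dhat_closed : invariant_class (@Dhat_closed).
Proof.
exact: invariant_generalized_closed _ _ _ invariant_D_open
  (invariant_smallest _ (invariant_setC _ invariant_semipreopen))
  invariant_op_id.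
Qed.

Lemma invariant_pigDhat_open : invariant_class (@pigDhat_open).
Proof.
exact: invariant_setC (invariant_generalized_closed _ _ _ invariant_pi_open
  (invariant_smallest _ invariant_Dhat_closed) invariant_op_id).
Qed.

Theorem corollary3p16 (X Y : topologicalType) :
  homeomorphic X Y -> softly_pigDhat_normal X -> softly_pigDhat_normal Y.
Proof.
move=> [f [g fg]] normX A B AB0 clAB; have [_ _ fK gK] := fg.
have gf := homeo_sym _ _ _ _ fg.
(* The sets to separate are pulled back to [X] along [f]. *)
have fAB0 : f @^-1` A `&` f @^-1` B = set0.
  by rewrite -preimage_setI AB0 preimage_set0.
have [|U [V [oU oV UV0 AU BV]]] := normX _ _ fAB0.
  have piinv := invariant_setC _ invariant_pi_open _ _ _ _ fg.
  have reginv := invariant_regclosed _ _ _ _ fg.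
  by case: clAB => -[clA clB]; [left|right]; split;
    by [exact: piinv|exact: reginv].
(* The separating sets found in [X] return to [Y] along [g], itself a homeomorphism. *)
exists (g @^-1` U), (g @^-1` V); split.
- exact: invariant_pigDhat_open _ _ _ _ gf _ oU.
- exact: invariant_pigDhat_open _ _ _ _ gf _ oV.
- by rewrite -preimage_setI UV0 preimage_set0.
- exact: sub_preimage_cancel gK _ _ AU.
- exact: sub_preimage_cancel gK _ _ BV.
Qed.
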